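(* Let $\alpha,\beta\in\mathbb{R}$, $x>0$, $\rho\in\mathbb{C}$. Then $$x^{-\alpha/2}J_\alpha\!\left(2\sqrt{x\rho}\right)=\rho^{\alpha/2}e^{-\rho}\sum_{k=0}^\infty\frac{\Gamma(\beta-\alpha+1)}{\Gamma(\beta+1+k)}\,L_{\beta-\alpha}^{\alpha+k}(\rho)\,\rho^k\,L_k^\beta(x).$$
   Context: Square roots and complex powers are principal. $(z)_n:=\prod_{i=1}^n(z+i-1)$ is the Pochhammer symbol and $M(a,b,z):=\sum_{n=0}^\infty\frac{(a)_n}{(b)_n}\frac{z^n}{n!}$ is Kummer's confluent hypergeometric function. The Bessel function of the first kind is $J_\nu(z):=\frac{(z/2)^\nu}{\Gamma(\nu+1)}\,{}_0F_1\left(-;\nu+1;-\frac{z^2}{4}\right)=\sum_{n=0}^\infty\frac{(-1)^n(z/2)^{2n+\nu}}{n!\,\Gamma(\nu+n+1)}$ ($1/\Gamma$ entire). The Laguerre polynomials are $L_n^\alpha(z):=\frac{(\alpha+1)_n}{n!}M(-n,\alpha+1,z)$, $n\in\mathbb{N}_0=\{0,1,2,\dots\}$, extended to all real $\alpha$ by continuity, i.e. $L_n^\alpha(z)=\sum_{j=0}^n\frac{(\alpha+j+1)_{n-j}}{(n-j)!\,j!}(-z)^j$. The Laguerre function is, for $\nu,\alpha\in\mathbb{C}$, $$L_\nu^\alpha(z):=\frac{\Gamma(1+\nu+\alpha)}{\Gamma(\nu+1)\Gamma(\alpha+1)}M(-\nu,\alpha+1,z).$$ Interpretation: when gamma factors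 are singular, the coefficient $\frac{\Gamma(\beta-\alpha+1)}{\Gamma(\beta+1+k)}L_{\beta-\alpha}^{\alpha+k}(\rho)$ is understood by continuity in the parameters as $\frac{M(\alpha-\beta,\alpha+k+1,\rho)}{\Gamma(\alpha+k+1)}=\sum_{n=0}^\infty\frac{(\alpha-\beta)_n\rho^n}{\Gamma(\alpha+k+n+1)\,n!}$. At $\rho=0$ the identity is understood after dividing both sides by $\rho^{\alpha/2}$ and letting $\rho\to0$. *)

(* Defs.v *)
(* Stdlib reals with Coquelicot. *)
From Stdlib Require Import Reals Factorial ClassicalEpsilon.
From Coquelicot Require Import Coquelicot.

Open Scope C_scope.

(* Limits and sums of complex sequences, as total functions; the value is
   arbitrary when the sequence (of partial sums) diverges. *)
Definition Clim_seq (u : nat -> C) : C :=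
  iota (T := C_CompleteNormedModule)
    (fun l : C => filterlim u eventually (locally l)).

Definition CSeries (a : nat -> C) : C :=
  iota (T := C_CompleteNormedModule)
    (fun s : C => is_series (V := C_NormedModule) a s).

Definition Cexp (z : C) : C :=
  (exp (Re z) * cos (Im z), exp (Re z) * sin (Im z))%R.

(* Principal argument, in (-PI, PI], of z <> 0. *)
Definition Carg (z : C) : R :=
  if Rle_dec 0 (Im z) then acos (Re z / Cmod z) else (- acos (Re z / Cmod z))%R.

Definition Clog (z : C) : C := (ln (Cmod z), Carg z).

(* Principal power; 0 ^ 0 = 1 and 0 ^ a = 0 for a <> 0 by convention.
   The infix ^ is Coquelicot's power with a natural exponent. *)
Definition Cpower (z a : C) : C :=
  if Ceq_dec z 0 then (if Ceq_dec a 0 then 1 else 0) else Cexp (a * Clog z).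

Definition Csqrt (z : C) : C := Cpower z (/ 2).

(* (z)_n = z (z + 1) ... (z + n - 1) *)
Fixpoint pochhammer (z : C) (n : nat) : C :=
  match n with
  | O => 1
  | S m => pochhammer z m * (z + INR m)
  end.

(* The entire function 1/Gamma by Euler's limit formula
     1/Gamma(z) = lim_n z (z + 1) ... (z + n) / (n! n^z),
   which is 0 at the poles 0, -1, -2, ... of Gamma. *)
Definition rGamma (z : C) : C :=
  Clim_seq (fun n => pochhammer z (S n) / (INR (fact n) * Cpower (INR n) z)).

Definition gamma_pole (z : C) : Prop := exists m : nat, z = - INR m.

(* Meaningful only when z is not a pole. *)
Definition CGamma (z : C) : C := / rGamma z.

(* Meaningful only when b is not in {0, -1, -2, ...}. *)
Definition KummerM (a b z : C) : C :=
  CSeries (fun n => pochhammer a n / pochhammer b n * (z ^ n / INR (fact n))).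

Definition BesselJ (nu z : C) : C :=
  CSeries (fun n => (- (1)) ^ n * Cpower (z / 2) (2 * INR n + nu)
                    / INR (fact n) * rGamma (nu + INR n + 1)).

Definition laguerre_poly (n : nat) (a z : C) : C :=
  sum_n (G := C_AbelianMonoid)
    (fun j => pochhammer (a + INR j + 1) (n - j)
              / (INR (fact (n - j)) * INR (fact j)) * (- z) ^ j) n.

Definition laguerre_fun (nu a z : C) : C :=
  CGamma (1 + nu + a) / (CGamma (nu + 1) * CGamma (a + 1))
  * KummerM (- nu) (a + 1) z.

(* Gamma(b-a+1) / Gamma(b+1+k) * L_{b-a}^{a+k}(rho), extended by continuity in
   (a, b) to the parameters for which one of its gamma factors
   Gamma(b-a+1), Gamma(b+1+k), Gamma(a+k+1) is singular. *)
Definition laguerre_coef (a b : C) (k : nat) (rho : C) : C :=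
  if excluded_middle_informative
       (gamma_pole (b - a + 1) \/ gamma_pole (b + 1 + INR k)
        \/ gamma_pole (a + INR k + 1))
  then CSeries (fun n => pochhammer (a - b) n * rho ^ n
                         * rGamma (a + INR k + INR n + 1) / INR (fact n))
  else CGamma (b - a + 1) / CGamma (b + 1 + INR k)
       * laguerre_fun (b - a) (a + INR k) rho.

(* Main.v *)
Require Import Defs.
From Stdlib Require Import Reals Factorial Lra Lia ClassicalEpsilon.
From Coquelicot Require Import Coquelicot.
Open Scope C_scope.

(** Write [G(w)] for the entire Bessel-Clifford series, the sum over [n] of
    [(-w)^n / (n! Gamma(alpha+n+1))].  On the principal branch
    [J_alpha(2 sqrt w) = w^(alpha/2) G(w)] (lemma [bessel_clifford]), so for
    [rho <> 0] the theorem says that the sum over [k] of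
    [coef_k(rho) rho^k L_k^beta(x)] is [exp(rho) G(x rho)].  This holds for
    every complex [rho] (lemma [laguerre_expansion]); together with the
    continuity of [G] at 0 it also settles the limits at [rho = 0].

    Two computations give [laguerre_expansion].  The coefficient is the series
    of [(alpha-beta)_n rho^n / (n! Gamma(alpha+k+n+1))] for regular and singular
    parameters alike (lemma [laguerre_coef_series]).  Summing the double series
    over [k] and [n] along the diagonals [k + n = m] leaves, as coefficient of
    [rho^m / Gamma(alpha+m+1)], the sum over [k <= m] of
    [(alpha-beta)_(m-k) / (m-k)! L_k^beta(x)], which is [L_m^alpha(x)]
    ([laguerre_poly_connection], a form of the Chu-Vandermonde identity).
    Expanding [L_m^alpha] and using
    [1/Gamma(alpha+j+1) = (alpha+j+1)_(m-j) / Gamma(alpha+m+1)] turns the same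
    diagonal sum into the Cauchy product of the series of [exp(rho)] and
    [G(x rho)].

    Both rearrangements are instances of [double_series_diagonal].  The
    domination it asks for comes from the decay of [1/Gamma(alpha+n+1)], at most
    a multiple of [2^n / n!], against which the Laguerre polynomials grow only
    geometrically in [k].

    The facts needed about 1/Gamma at real arguments, namely the existence of
    Euler's limit, the functional equation and the absence of zeros other than
    the poles of Gamma, follow from two monotone sequences with a common limit
    when the argument is positive, and from the functional equation elsewhere. *)

(** * Limits and sums of complex sequences *)

(* Sums of complex sequences live in a structure whose carrier only unfolds to
   C, while ring and field look for C itself. *)
Ltac to_C := match goal with |- @eq _ ?a ?b => change (@eq C a b) end.
Ltac cring := to_C; ring.
Ltac cfield := to_C; field.

Lemma Cfilterlim_Cmod (u : nat -> C) (l : C) :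
  filterlim u eventually (locally l)
  <-> is_lim_seq (fun n => Cmod (u n - l)) 0.
Proof.
  split.
  - intros H.
    pose proof (proj1 (filterlim_locally_ball_norm (U := C_NormedModule) u l) H) as H'.
    apply is_lim_seq_spec. intros eps. destruct (H' eps) as [N HN].
    exists N. intros n Hn. rewrite Rminus_0_r, Rabs_pos_eq by apply Cmod_ge_0.
    exact (HN n Hn).
  - intros H. apply is_lim_seq_spec in H.
    apply (filterlim_locally_ball_norm (U := C_NormedModule) u l).
    intros eps. destruct (H eps) as [N HN]. exists N. intros n Hn.
    specialize (HN n Hn).
    rewrite Rminus_0_r, Rabs_pos_eq in HN by apply Cmod_ge_0. exact HN.
Qed.

Lemma filterlim_RtoC_seq (u : nat -> R) (l : R) :
  is_lim_seq u l -> filterlim (fun n => RtoC (u n)) eventually (locally (RtoC l)).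
Proof.
  intros H. apply Cfilterlim_Cmod.
  apply is_lim_seq_ext with (fun n => Rabs (u n - l)).
  - intros n. rewrite <- RtoC_minus, Cmod_R. reflexivity.
  - apply (is_lim_seq_abs_0 (fun n => (u n - l)%R)).
    replace 0%R with (l - l)%R by ring.
    apply is_lim_seq_minus'; [exact H | apply is_lim_seq_const].
Qed.

Lemma Clim_seq_unique (u : nat -> C) (l : C) :
  filterlim u eventually (locally l) -> Clim_seq u = l.
Proof.
  apply (iota_filterlim_locally (V := C_CompleteNormedModule)).
Qed.

Lemma CSeries_unique (a : nat -> C) (s : C) :
  is_series (V := C_NormedModule) a s -> CSeries a = s.
Proof.
  apply (iota_filterlim_locally (V := C_CompleteNormedModule)
           (fun n => sum_n (G := C_AbelianMonoid) a n)).
Qed.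

Lemma CSeries_correct (a : nat -> C) :
  ex_series (V := C_NormedModule) a ->
  is_series (V := C_NormedModule) a (CSeries a).
Proof. intros [s Hs]. rewrite (CSeries_unique a s Hs). exact Hs. Qed.

Lemma Cis_series_unique (a : nat -> C) (s t : C) :
  is_series (V := C_NormedModule) a s -> is_series (V := C_NormedModule) a t ->
  s = t.
Proof. intros Hs Ht. rewrite <- (CSeries_unique a s Hs). now apply CSeries_unique. Qed.

Lemma Cex_series_dominated (a : nat -> C) (b : nat -> R) :
  (forall n, Cmod (a n) <= b n)%R -> ex_series b ->
  ex_series (V := C_NormedModule) a.
Proof. exact (ex_series_le (V := C_CompleteNormedModule) a b). Qed.

Lemma Csum_Sn (a : nat -> C) (n : nat) :
  sum_n (G := C_AbelianMonoid) a (S n) = sum_n (G := C_AbelianMonoid) a n + a (S n).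
Proof. exact (sum_Sn a n). Qed.

Lemma Csum_mult_l (z : C) (a : nat -> C) (n : nat) :
  sum_n (G := C_AbelianMonoid) (fun k => z * a k) n
  = z * sum_n (G := C_AbelianMonoid) a n.
Proof. exact (sum_n_mult_l (K := C_Ring) z a n). Qed.

Lemma Csum_plus (a b : nat -> C) (n : nat) :
  sum_n (G := C_AbelianMonoid) (fun k => a k + b k) n
  = sum_n (G := C_AbelianMonoid) a n + sum_n (G := C_AbelianMonoid) b n.
Proof. exact (sum_n_plus a b n). Qed.

Lemma Rsum_Sn (a : nat -> R) (n : nat) :
  sum_n a (S n) = (sum_n a n + a (S n))%R.
Proof. exact (sum_Sn a n). Qed.

Lemma Rsum_minus (a b : nat -> R) (n : nat) :
  sum_n (fun k => a k - b k)%R n = (sum_n a n - sum_n b n)%R.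
Proof. rewrite !sum_n_Reals. apply minus_sum. Qed.

Lemma Rsum_mult_r (a : nat -> R) (x : R) (n : nat) :
  sum_n (fun k => a k * x)%R n = (sum_n a n * x)%R.
Proof. exact (sum_n_mult_r (K := R_Ring) x a n). Qed.

Lemma Cmod_sum_le (a : nat -> C) (b : nat -> R) (N : nat) :
  (forall k, (k <= N)%nat -> Cmod (a k) <= b k)%R ->
  (Cmod (sum_n (G := C_AbelianMonoid) a N) <= sum_n b N)%R.
Proof.
  induction N as [|N IH]; intros H.
  - rewrite !sum_O. now apply H.
  - rewrite Csum_Sn, Rsum_Sn.
    eapply Rle_trans; [apply Cmod_triangle|].
    apply Rplus_le_compat; [apply IH; intros; apply H|apply H]; lia.
Qed.

Lemma sum_n_triangle {G : AbelianMonoid} (f : nat -> nat -> G) (N : nat) :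
  sum_n (fun m => sum_n (fun k => f k (m - k)%nat) m) N
  = sum_n (fun k => sum_n (f k) (N - k)) N.
Proof.
  induction N as [|N IH].
  - now rewrite !sum_O.
  - rewrite sum_Sn, IH, (sum_Sn (fun k => sum_n (f k) (S N - k))), sum_Sn.
    rewrite Nat.sub_diag, sum_O.
    rewrite plus_assoc, <- sum_n_plus. apply (f_equal2 plus); [|reflexivity].
    apply sum_n_ext_loc. intros k Hk.
    replace (S N - k)%nat with (S (N - k)) by lia. now rewrite sum_Sn.
Qed.

(** The tail of a series is bounded by the tail of a dominating series; the
    bound is stated as a difference, which telescopes when it is summed. *)
Lemma Cmod_series_tail_le (a : nat -> C) (b : nat -> R) (s : C) (t : R) (m : nat) :
  (forall n, Cmod (a n) <= b n)%R ->
  is_series (V := C_NormedModule) a s -> is_series b t ->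
  (Cmod (s - sum_n (G := C_AbelianMonoid) a m) <= t - sum_n b m)%R.
Proof.
  intros Hab Ha Hb.
  assert (Hp : forall p, (Cmod (sum_n (G := C_AbelianMonoid) a (p + m)
                     - sum_n (G := C_AbelianMonoid) a m)
               <= sum_n b (p + m) - sum_n b m)%R).
  { induction p as [|p IH]; simpl.
    - replace (_ - _) with (RtoC 0) by cring. rewrite Cmod_0. lra.
    - rewrite Csum_Sn, Rsum_Sn.
      replace (_ + _ - _) with ((sum_n (G := C_AbelianMonoid) a (p + m)
                     - sum_n (G := C_AbelianMonoid) a m) + a (S (p + m)))
        by cring.
      eapply Rle_trans; [apply Cmod_triangle|]. specialize (Hab (S (p + m))). lra. }
  assert (Ha' := proj1 (Cfilterlim_Cmod _ _) Ha).
  assert (Hb' : is_lim_seq (sum_n b) t) by exact Hb.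
  apply (is_lim_seq_incr_n _ m) in Ha'. apply (is_lim_seq_incr_n _ m) in Hb'.
  refine (is_lim_seq_le (fun _ => Cmod (s - sum_n (G := C_AbelianMonoid) a m))
    (fun p => Cmod (sum_n (G := C_AbelianMonoid) a (p + m) - s)
              + (sum_n b (p + m) - sum_n b m))%R
    (Cmod (s - sum_n (G := C_AbelianMonoid) a m)) (t - sum_n b m)%R _ _ _).
  - intros p. specialize (Hp p).
    set (A := sum_n (G := C_AbelianMonoid) a (p + m)) in *.
    set (B := sum_n (G := C_AbelianMonoid) a m) in *.
    rewrite <- (Cmod_opp (A - s)).
    replace (s - B) with (- (A - s) + (A - B)) by cring.
    eapply Rle_trans; [apply Cmod_triangle|]. lra.
  - apply is_lim_seq_const.
  - replace (t - sum_n b m)%R with (0 + (t - sum_n b m))%R by ring.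
    apply is_lim_seq_plus'; [exact Ha'|].
    apply is_lim_seq_minus'; [exact Hb'|apply is_lim_seq_const].
Qed.

(** A double series dominated by a product [b k * c n] may be summed along its
    diagonals.  The difference of the two partial sums is a sum of row tails;
    it is at most the same expression for the dominating double series, which
    tends to 0 by Mertens' theorem on the product of two positive series. *)
Lemma double_series_diagonal (f : nat -> nat -> C) (b c : nat -> R) (F : nat -> C) :
  (forall k, 0 <= b k)%R -> (forall n, 0 <= c n)%R ->
  ex_series b -> ex_series c ->
  (forall k n, Cmod (f k n) <= b k * c n)%R ->
  (forall k, is_series (V := C_NormedModule) (f k) (F k)) ->
  exists s, is_series (V := C_NormedModule) F s
    /\ is_series (V := C_NormedModule)
         (fun m => sum_n (G := C_AbelianMonoid) (fun k => f k (m - k)%nat) m) s.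
Proof.
  intros b_ge0 c_ge0 [B HB] [D HD] Hf HF.
  assert (Hrow : forall k m,
    (Cmod (F k - sum_n (G := C_AbelianMonoid) (f k) m)
     <= b k * D - sum_n (fun n => b k * c n) m)%R).
  { intros k m. apply Cmod_series_tail_le; [apply Hf|apply HF|].
    exact (is_series_scal_l (b k) c D HD). }
  assert (HexF : ex_series (V := C_NormedModule) F).
  { apply Cex_series_dominated with (fun k => b k * D)%R.
    - intros k. specialize (Hrow k 0%nat). rewrite !sum_O in Hrow.
      assert (H0 := Hf k 0%nat).
      replace (F k) with ((F k - f k 0%nat) + f k 0%nat) by ring.
      eapply Rle_trans; [apply Cmod_triangle|]. lra.
    - exists (B * D)%R. exact (is_series_scal_r D b B HB). }
  destruct HexF as [s Hs]. exists s. split; [exact Hs|].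
  assert (HM := is_series_mult_pos b c B D HB HD b_ge0 c_ge0).
  assert (HM' : is_lim_seq
    (fun N => (sum_n b N * D
       - sum_n (fun m => sum_n (fun k => b k * c (m - k)%nat)%R m) N)%R) 0).
  { replace 0%R with (B * D - B * D)%R by ring. apply is_lim_seq_minus'.
    - apply (is_lim_seq_scal_r (sum_n b) D B). exact HB.
    - apply (is_series_ext _ (fun m => sum_n (fun k => b k * c (m - k)%nat)%R m))
        in HM; [exact HM|].
      intros m. now rewrite sum_n_Reals. }
  apply Cfilterlim_Cmod.
  assert (Hs' := proj1 (Cfilterlim_Cmod _ _) Hs).
  apply is_lim_seq_le_le with (fun _ => 0%R)
    (fun N => (sum_n b N * D
       - sum_n (fun m => sum_n (fun k => b k * c (m - k)%nat)%R m) N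
       + Cmod (sum_n (G := C_AbelianMonoid) F N - s))%R).
  - intros N. split; [apply Cmod_ge_0|].
    change (Cmod (sum_n (G := C_AbelianMonoid)
      (fun m => sum_n (G := C_AbelianMonoid) (fun k => f k (m - k)%nat) m) N - s)
      <= sum_n b N * D
         - sum_n (fun m => sum_n (fun k => b k * c (m - k)%nat)%R m) N
         + Cmod (sum_n (G := C_AbelianMonoid) F N - s))%R.
    rewrite (sum_n_triangle f N).
    rewrite (sum_n_triangle (G := R_AbelianMonoid) (fun k n => b k * c n)%R N).
    set (T := sum_n (G := C_AbelianMonoid)
                (fun k => sum_n (G := C_AbelianMonoid) (f k) (N - k)) N).
    replace (T - s) with (- (sum_n (G := C_AbelianMonoid) F N - T)
       + (sum_n (G := C_AbelianMonoid) F N - s)) by cring.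
    eapply Rle_trans; [apply Cmod_triangle|].
    rewrite Cmod_opp. apply Rplus_le_compat_r.
    assert (E1 : sum_n (G := C_AbelianMonoid) F N - T = sum_n (G := C_AbelianMonoid)
      (fun k => F k - sum_n (G := C_AbelianMonoid) (f k) (N - k)) N).
    { symmetry. unfold T, Cminus. rewrite Csum_plus. f_equal.
      transitivity (-(1) * T); [|unfold T; cring].
      unfold T. rewrite <- Csum_mult_l. apply sum_n_ext. intros; cring. }
    assert (E2 : (sum_n b N * D
       - sum_n (fun k => sum_n (fun n => b k * c n) (N - k)) N
       = sum_n (fun k => b k * D - sum_n (fun n => b k * c n) (N - k)) N)%R).
    { now rewrite Rsum_minus, Rsum_mult_r. }
    rewrite E1, E2. apply Cmod_sum_le. intros k _. apply Hrow.
  - apply is_lim_seq_const.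
  - replace (Finite 0) with (Finite (0 + 0)) by (f_equal; ring).
    apply is_lim_seq_plus'; assumption.
Qed.

(** * Principal logarithm and powers *)

Lemma Cexp_plus (z w : C) : Cexp (z + w) = Cexp z * Cexp w.
Proof.
  destruct z as [a b], w as [c d]. unfold Cexp, Cmult; simpl.
  rewrite exp_plus, cos_plus, sin_plus. f_equal; ring.
Qed.

Lemma Cexp_RtoC (t : R) : Cexp t = exp t.
Proof. unfold Cexp, RtoC; simpl. rewrite cos_0, sin_0. f_equal; ring. Qed.

Lemma Cexp_neq_0 (z : C) : Cexp z <> 0.
Proof.
  intros H. assert (E : Cexp z * Cexp (- z) = 1).
  { rewrite <- Cexp_plus, Cplus_opp_r, Cexp_RtoC, exp_0. reflexivity. }
  rewrite H, Cmult_0_l in E. now apply C1_nz.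
Qed.

Lemma Cexp_opp (z : C) : Cexp (- z) = / Cexp z.
Proof.
  assert (E : Cexp z * Cexp (- z) = 1).
  { rewrite <- Cexp_plus, Cplus_opp_r, Cexp_RtoC, exp_0. reflexivity. }
  rewrite <- (Cmult_1_l (/ Cexp z)), <- E. field. apply Cexp_neq_0.
Qed.

Lemma Cexp_INR_mult (n : nat) (z : C) : Cexp (INR n * z) = Cexp z ^ n.
Proof.
  induction n as [|n IH].
  - simpl. rewrite Cmult_0_l, Cexp_RtoC, exp_0. reflexivity.
  - rewrite S_INR, RtoC_plus, Cmult_plus_distr_r, Cexp_plus, IH, Cmult_1_l, Cpow_S.
    ring.
Qed.

Lemma Cmod_Cexp (z : C) : Cmod (Cexp z) = exp (Re z).
Proof.
  unfold Cmod, Cexp; simpl.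
  replace (_ + _)%R with (exp (Re z) * exp (Re z)
    * ((sin (Im z))² + (cos (Im z))²))%R by (unfold Rsqr; ring).
  rewrite sin2_cos2, Rmult_1_r. apply sqrt_square. left; apply exp_pos.
Qed.

Lemma Re_over_Cmod_bound (z : C) : z <> 0 -> (-1 <= Re z / Cmod z <= 1)%R.
Proof.
  intros Hz. apply Cmod_gt_0 in Hz. assert (H := re_le_Cmod z).
  apply Rabs_le_between in H.
  split; [apply Rle_div_r | apply Rle_div_l]; lra.
Qed.

Lemma Im_over_Cmod (z : C) :
  z <> 0 -> sqrt (1 - (Re z / Cmod z)²) = (Rabs (Im z) / Cmod z)%R.
Proof.
  intros Hz. apply Cmod_gt_0 in Hz. assert (H := Cmod2_alt z).
  replace (1 - (Re z / Cmod z)²)%R with ((Im z / Cmod z)²)%R.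
  - rewrite sqrt_Rsqr_abs. unfold Rdiv. rewrite Rabs_mult.
    f_equal. apply Rabs_pos_eq. left; now apply Rinv_0_lt_compat.
  - replace (1 - (Re z / Cmod z)²)%R
      with ((Cmod z ^ 2 - Re z ^ 2) / Cmod z ^ 2)%R
      by (unfold Rsqr; field; lra).
    replace (Cmod z ^ 2 - Re z ^ 2)%R with (Im z ^ 2)%R by lra.
    unfold Rsqr; field; lra.
Qed.

Lemma Cexp_Clog (z : C) : z <> 0 -> Cexp (Clog z) = z.
Proof.
  intros Hz. assert (Hm := proj1 (Cmod_gt_0 z) Hz).
  assert (Hb := Re_over_Cmod_bound z Hz).
  assert (Hi := Im_over_Cmod z Hz).
  unfold Cexp, Clog; simpl. rewrite exp_ln by exact Hm.
  rewrite (surjective_pairing z) at 5. fold (Re z) (Im z).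
  unfold Carg. destruct (Rle_dec 0 (Im z)) as [H|H].
  - rewrite cos_acos, sin_acos, Hi, Rabs_pos_eq by assumption.
    f_equal; field; lra.
  - rewrite cos_neg, sin_neg, cos_acos, sin_acos, Hi, Rabs_left by (assumption || lra).
    f_equal; field; lra.
Qed.

Lemma Carg_bound (z : C) : z <> 0 -> (- PI < Carg z <= PI)%R.
Proof.
  intros Hz. assert (Hm := proj1 (Cmod_gt_0 z) Hz).
  assert (HP := PI_RGT_0). assert (Hb := Re_over_Cmod_bound z Hz).
  assert (Ha := acos_bound (Re z / Cmod z)).
  unfold Carg. destruct (Rle_dec 0 (Im z)) as [H|H]; [lra|].
  assert (acos (Re z / Cmod z) <> PI); [|lra].
  intros E. assert (Es := sin_acos _ Hb). rewrite E, sin_PI, Im_over_Cmod in Es by exact Hz.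
  rewrite Rabs_left in Es by lra.
  assert (0 < - Im z / Cmod z)%R by (apply Rdiv_lt_0_compat; lra). lra.
Qed.

(** [acos (cos t)] is [|t|] on this strip, and the sign of [sin t], which the
    argument tests, restores the sign of [t]. *)
Lemma Clog_Cexp (w : C) : (- PI < Im w <= PI)%R -> Clog (Cexp w) = w.
Proof.
  intros Hw. unfold Clog. rewrite Cmod_Cexp, ln_exp.
  rewrite (surjective_pairing w) at 3. fold (Re w) (Im w). f_equal.
  unfold Carg. rewrite Cmod_Cexp. unfold Cexp; simpl.
  assert (He := exp_pos (Re w)).
  replace (exp (Re w) * cos (Im w) / exp (Re w))%R with (cos (Im w)) by (field; lra).
  destruct (Rle_dec _ _) as [H|H].
  - apply acos_cos. split; [|lra].
    destruct (Rle_or_lt 0 (Im w)) as [|Hn]; [assumption|].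
    assert (sin (Im w) < 0)%R by (apply sin_lt_0_var; lra). nra.
  - rewrite <- (cos_neg (Im w)), acos_cos; [ring|]. split; [|lra].
    destruct (Rle_or_lt (Im w) 0) as [|Hn]; [lra|].
    assert (0 <= sin (Im w))%R by (apply sin_ge_0; lra). nra.
Qed.

Lemma Clog_scale (x : R) (z : C) :
  (0 < x)%R -> z <> 0 -> Clog (x * z) = ln x + Clog z.
Proof.
  intros Hx Hz. rewrite <- (Clog_Cexp (ln x + Clog z)).
  - f_equal. rewrite Cexp_plus, Cexp_RtoC, exp_ln, Cexp_Clog by assumption. reflexivity.
  - simpl. assert (H := Carg_bound z Hz). lra.
Qed.

(** Halving an argument of (-PI, PI] keeps it in that interval. *)
Lemma Clog_Csqrt (z : C) : z <> 0 -> Clog (Csqrt z) = / 2 * Clog z.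
Proof.
  intros Hz. unfold Csqrt, Cpower. destruct (Ceq_dec z 0) as [|_]; [contradiction|].
  apply Clog_Cexp. rewrite <- RtoC_inv by lra. rewrite im_scal_l.
  assert (H := Carg_bound z Hz). simpl. lra.
Qed.

Lemma Csqrt_neq_0 (z : C) : z <> 0 -> Csqrt z <> 0.
Proof.
  intros Hz. unfold Csqrt, Cpower. destruct (Ceq_dec z 0); [contradiction|].
  apply Cexp_neq_0.
Qed.

Lemma Cpower_neq (z a : C) : z <> 0 -> Cpower z a = Cexp (a * Clog z).
Proof. intros Hz. unfold Cpower. now destruct (Ceq_dec z 0). Qed.

Lemma RtoC_neq_0 (t : R) : t <> 0%R -> RtoC t <> 0.
Proof. intros H E. apply H. now apply RtoC_inj. Qed.

Lemma Cpower_RtoC (t a : R) : (0 < t)%R -> Cpower t a = Rpower t a.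
Proof.
  intros Ht. rewrite Cpower_neq by (apply RtoC_neq_0; lra).
  assert (E : Clog t = ln t).
  { rewrite <- (Clog_Cexp (ln t)), Cexp_RtoC, exp_ln by
      (exact Ht || (assert (H := PI_RGT_0); simpl; lra)). reflexivity. }
  rewrite E, <- RtoC_mult, Cexp_RtoC. reflexivity.
Qed.

(** The square root in the argument of the Bessel function turns the exponent
    [2 n + nu] into [n + nu / 2]: a nonnegative power of [x r] times the factor
    [r ^ (nu / 2)] of the identity and a real power of [x]. *)
Lemma Cpower_Csqrt (x nu : R) (r : C) (n : nat) :
  (0 < x)%R -> r <> 0 ->
  Rpower x (- nu / 2) * Cpower (2 * Csqrt (x * r) / 2) (2 * INR n + nu)
  = Cpower r (nu / 2) * (x * r) ^ n.
Proof.
  intros Hx Hr.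
  assert (Hxr : x * r <> 0) by (apply Cmult_neq_0; [apply RtoC_neq_0; lra|exact Hr]).
  replace (2 * Csqrt (x * r) / 2) with (Csqrt (x * r)) by field.
  rewrite Cpower_neq by now apply Csqrt_neq_0.
  rewrite Clog_Csqrt by exact Hxr.
  rewrite (Cpower_neq r) by exact Hr.
  replace ((2 * INR n + nu) * (/ 2 * Clog (x * r)))
    with (nu / 2 * ln x + (nu / 2 * Clog r + INR n * Clog (x * r))).
  - rewrite !Cexp_plus, Cexp_INR_mult, (Cexp_Clog (x * r)) by exact Hxr.
    unfold Rpower. rewrite <- Cexp_RtoC, Cmult_assoc, <- Cexp_plus.
    replace (RtoC (- nu / 2 * ln x)) with (- (nu / 2 * ln x)).
    + replace (- (nu / 2 * ln x) + nu / 2 * ln x) with (RtoC 0) by ring.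
      rewrite Cexp_RtoC, exp_0. ring.
    + rewrite RtoC_mult, RtoC_div, RtoC_opp by lra. field.
  - rewrite (Clog_scale x r) by assumption. field.
Qed.

(** * The reciprocal gamma function on the real line *)

Fixpoint rising (a : R) (n : nat) : R :=
  match n with
  | O => 1%R
  | S m => (rising a m * (a + INR m))%R
  end.

Lemma pochhammer_RtoC (a : R) (n : nat) : pochhammer a n = rising a n.
Proof.
  induction n as [|n IH]; [reflexivity|].
  simpl pochhammer. rewrite IH, <- RtoC_plus, <- RtoC_mult. reflexivity.
Qed.

Lemma rising_pos (a : R) (n : nat) : (0 < a)%R -> (0 < rising a n)%R.
Proof.
  intros Ha. induction n as [|n IH]; simpl; [lra|].
  apply Rmult_lt_0_compat; [exact IH|]. assert (H := pos_INR n). lra.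
Qed.

Lemma rising_shift (a : R) (n : nat) :
  (a * rising (a + 1) n = rising a (S n))%R.
Proof.
  induction n as [|n IH]; [simpl; ring|].
  change (rising (a + 1) (S n)) with (rising (a + 1) n * (a + 1 + INR n))%R.
  rewrite <- Rmult_assoc, IH.
  change (rising a (S (S n))) with (rising a (S n) * (a + INR (S n)))%R.
  rewrite S_INR. ring.
Qed.

Definition euler_quotient (a : R) (n : nat) : R :=
  (rising a (S n) / (INR (fact n) * Rpower (INR n) a))%R.

Lemma INR_fact_pos (n : nat) : (0 < INR (fact n))%R.
Proof. apply lt_0_INR, lt_O_fact. Qed.

Lemma INR_fact_S (n : nat) : INR (fact (S n)) = (INR (S n) * INR (fact n))%R.
Proof. rewrite <- mult_INR. reflexivity. Qed.

Lemma Rpower_pos (x a : R) : (0 < Rpower x a)%R.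
Proof. apply exp_pos. Qed.

Lemma ln_succ_ge (t : R) : (0 < t)%R -> (/ (t + 1) <= ln (t + 1) - ln t)%R.
Proof.
  intros Ht.
  assert (H := exp_ineq1_le (ln t - ln (t + 1))).
  unfold Rminus in H at 2. rewrite exp_plus, exp_Ropp, !exp_ln in H by lra.
  assert (E : (t * / (t + 1) = 1 - / (t + 1))%R) by (field; lra). lra.
Qed.

Lemma Rpower_ratio_ge (a m s t : R) :
  (0 < s)%R -> (0 < t)%R -> (a / m <= a * (ln t - ln s))%R ->
  ((1 + a / m) * Rpower s a <= Rpower t a)%R.
Proof.
  intros Hs Ht H. unfold Rpower.
  replace (a * ln t)%R with (a * (ln t - ln s) + a * ln s)%R by ring.
  rewrite exp_plus. apply Rmult_le_compat_r; [left; apply exp_pos|].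
  eapply Rle_trans; [apply exp_ineq1_le|].
  destruct H as [H|H]; [left; now apply exp_increasing|now rewrite H; right].
Qed.

(** Euler's quotient decreases, because [1 + a / m <= (m / (m - 1)) ^ a]. *)
Lemma euler_quotient_decr (a : R) (n : nat) :
  (0 < a)%R -> (1 <= n)%nat -> (euler_quotient a (S n) <= euler_quotient a n)%R.
Proof.
  intros Ha Hn. unfold euler_quotient.
  assert (Hn' : (1 <= INR n)%R) by (change 1%R with (INR 1); now apply le_INR).
  assert (Hp := rising_pos a (S n) Ha). assert (Hf := INR_fact_pos n).
  assert (H1 := Rpower_pos (INR n) a). assert (H2 := Rpower_pos (INR (S n)) a).
  assert (H := ln_succ_ge (INR n) ltac:(lra)).
  assert (HR : ((1 + a / INR (S n)) * Rpower (INR n) a <= Rpower (INR (S n)) a)%R).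
  { apply Rpower_ratio_ge; rewrite ?S_INR; try lra. unfold Rdiv. nra. }
  change (rising a (S (S n))) with (rising a (S n) * (a + INR (S n)))%R.
  rewrite INR_fact_S. set (m := INR (S n)) in *.
  assert (Hm : (0 < m)%R) by (unfold m; rewrite S_INR; lra).
  replace (rising a (S n) * (a + m) / (m * INR (fact n) * Rpower m a))%R
    with (rising a (S n) / (INR (fact n) * Rpower (INR n) a)
          * ((1 + a / m) * Rpower (INR n) a / Rpower m a))%R by (field; lra).
  rewrite <- (Rmult_1_r (_ / _)) at 2.
  apply Rmult_le_compat_l.
  - left. apply Rdiv_lt_0_compat; [exact Hp|]. now apply Rmult_lt_0_compat.
  - apply Rle_div_l; lra.
Qed.

(** Replacing the base [n] by [n + 1 + a] in Euler's quotient turns it into an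
    increasing sequence, since [(1 + 1 / (m + a)) ^ a <= 1 + a / m].  It stays
    below Euler's quotient and so bounds the limit away from 0. *)
Lemma euler_quotient_shifted_incr (a : R) (n : nat) :
  (0 < a)%R ->
  (rising a (S n) / (INR (fact n) * Rpower (INR n + 1 + a) a)
   <= rising a (S (S n)) / (INR (fact (S n)) * Rpower (INR (S n) + 1 + a) a))%R.
Proof.
  intros Ha. assert (Hn := pos_INR n).
  assert (Hp := rising_pos a (S n) Ha). assert (Hf := INR_fact_pos n).
  assert (H1 := Rpower_pos (INR n + 1 + a) a).
  assert (H2 := Rpower_pos (INR (S n) + 1 + a) a).
  change (rising a (S (S n))) with (rising a (S n) * (a + INR (S n)))%R.
  rewrite INR_fact_S.
  assert (HR : (Rpower (INR (S n) + 1 + a) a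
                <= (1 + a / INR (S n)) * Rpower (INR n + 1 + a) a)%R).
  { rewrite S_INR. set (m := (INR n + 1)%R). assert (Hm : (0 < m)%R) by (unfold m; lra).
    unfold Rpower.
    replace (1 + a / m)%R with (exp (ln ((m + a) / m)))
      by (rewrite exp_ln by (apply Rdiv_lt_0_compat; lra); field; lra).
    rewrite <- exp_plus.
    assert (L : (a * ln (m + 1 + a) <= ln ((m + a) / m) + a * ln (m + a))%R).
    { assert (HA := exp_ineq1_le (ln (m + 1 + a) - ln (m + a))).
      unfold Rminus in HA at 2. rewrite exp_plus, exp_Ropp, !exp_ln in HA by lra.
      assert (HB := exp_ineq1_le (ln m - ln (m + a))).
      unfold Rminus in HB at 2. rewrite exp_plus, exp_Ropp, !exp_ln in HB by lra.
      rewrite ln_div by lra.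
      assert (EA : ((m + 1 + a) * / (m + a) = 1 + / (m + a))%R) by (field; lra).
      assert (EB : (m * / (m + a) = 1 - a * / (m + a))%R) by (field; lra).
      rewrite EA in HA. rewrite EB in HB. nra. }
    destruct L as [L|L]; [left; now apply exp_increasing|rewrite L; now right]. }
  set (m := INR (S n)) in *.
  assert (Hm : (0 < m)%R) by (unfold m; rewrite S_INR; lra).
  set (P1 := Rpower (INR n + 1 + a) a) in *. set (P2 := Rpower (m + 1 + a) a) in *.
  replace (rising a (S n) * (a + m) / (m * INR (fact n) * P2))%R
    with (rising a (S n) / (INR (fact n) * P1) * ((1 + a / m) * P1 / P2))%R
    by (field; lra).
  rewrite <- (Rmult_1_r (_ / _)) at 1.
  apply Rmult_le_compat_l.
  - left. apply Rdiv_lt_0_compat; [exact Hp|]. now apply Rmult_lt_0_compat.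
  - apply Rle_div_r; lra.
Qed.

Lemma euler_quotient_lim_pos (a : R) :
  (0 < a)%R -> exists l : R, (0 < l)%R /\ is_lim_seq (euler_quotient a) l.
Proof.
  intros Ha.
  set (w := fun n => (rising a (S n) / (INR (fact n) * Rpower (INR n + 1 + a) a))%R).
  assert (Hw0 : (0 < w 0%nat)%R).
  { apply Rdiv_lt_0_compat; [now apply rising_pos|].
    apply Rmult_lt_0_compat; [apply INR_fact_pos|apply Rpower_pos]. }
  assert (Hw : forall n, (w 0%nat <= w n)%R).
  { induction n as [|n IH]; [lra|].
    eapply Rle_trans; [exact IH|]. now apply euler_quotient_shifted_incr. }
  assert (Hlow : forall n, (w 0%nat <= euler_quotient a (S n))%R).
  { intros n. eapply Rle_trans; [apply (Hw (S n))|].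
    unfold w, euler_quotient, Rdiv. apply Rmult_le_compat_l.
    - left. now apply rising_pos.
    - assert (Hf := INR_fact_pos (S n)). assert (H1 := Rpower_pos (INR (S n)) a).
      apply Rinv_le_contravar; [now apply Rmult_lt_0_compat|].
      apply Rmult_le_compat_l; [lra|]. apply Rle_Rpower_l; [lra|].
      assert (H := pos_INR n). rewrite S_INR. lra. }
  destruct (ex_finite_lim_seq_decr (fun n => euler_quotient a (S n)) (w 0%nat))
    as [l Hl].
  - intros n. apply euler_quotient_decr; [exact Ha|lia].
  - exact Hlow.
  - exists l. split; [|now apply is_lim_seq_incr_1].
    assert (H := is_lim_seq_le _ _ (w 0%nat) l Hlow (is_lim_seq_const _) Hl).
    simpl in H. lra.
Qed.

Lemma is_lim_seq_INR_ratio (b : R) :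
  is_lim_seq (fun n => INR n / (INR n + b))%R 1%R.
Proof.
  apply is_lim_seq_ext_loc with (fun n => 1 - b * / (INR n + b))%R.
  - destruct (nfloor_ex (Rabs b)) as [N [_ HN]]; [apply Rabs_pos|].
    exists (S N). intros n Hn. apply le_INR in Hn. rewrite S_INR in Hn.
    assert (H := Rabs_le_between b (Rabs b)). destruct H as [H _].
    specialize (H (Rle_refl _)). field. lra.
  - replace (Finite 1) with (Finite (1 - b * 0)) by (f_equal; ring).
    apply is_lim_seq_minus'; [apply is_lim_seq_const|].
    apply (is_lim_seq_scal_l _ b 0).
    apply (is_lim_seq_inv _ p_infty); [|easy].
    apply (is_lim_seq_plus _ _ p_infty b); [apply is_lim_seq_INR| |easy].
    apply is_lim_seq_const.
Qed.

(** The functional equation 1/Gamma(a) = a/Gamma(a+1) holds for Euler's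
    quotients up to the factor n/(n+a+1), which tends to 1. *)
Lemma euler_quotient_lim_shift (a l : R) :
  is_lim_seq (euler_quotient (a + 1)) l -> is_lim_seq (euler_quotient a) (a * l)%R.
Proof.
  intros H.
  apply is_lim_seq_ext_loc with
    (fun n => a * euler_quotient (a + 1) n * (INR n / (INR n + (a + 1))))%R.
  - destruct (nfloor_ex (Rabs (a + 1))) as [N [_ HN]]; [apply Rabs_pos|].
    exists (S N). intros n Hn. apply le_INR in Hn. rewrite S_INR in Hn.
    assert (Hb := Rabs_le_between (a + 1) (Rabs (a + 1))). destruct Hb as [Hb _].
    specialize (Hb (Rle_refl _)). assert (HN0 := pos_INR N).
    assert (Hf := INR_fact_pos n). assert (H1 := Rpower_pos (INR n) a).
    unfold euler_quotient. rewrite Rpower_plus, Rpower_1 by lra.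
    rewrite <- (rising_shift a n). simpl rising. field. lra.
  - replace (a * l)%R with (a * l * 1)%R by ring.
    apply (is_lim_seq_mult' _ _ (a * l)%R 1%R); [|apply is_lim_seq_INR_ratio].
    exact (is_lim_seq_scal_l _ a l H).
Qed.

(** Going left from the positive axis by the functional equation, the limit can
    only vanish through a factor [a + m = 0], that is, at a pole of Gamma. *)
Lemma euler_quotient_lim (a : R) :
  exists l : R, is_lim_seq (euler_quotient a) l
    /\ (l = 0%R -> exists m : nat, a = (- INR m)%R).
Proof.
  assert (H : forall n a, (- INR n < a)%R -> exists l : R,
    is_lim_seq (euler_quotient a) l /\ (l = 0%R -> exists m : nat, a = (- INR m)%R)).
  { clear a. induction n as [|n IH]; intros a Ha.
    - simpl in Ha. destruct (euler_quotient_lim_pos a) as [l [Hl Hlim]]; [lra|].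
      exists l. split; [exact Hlim|]. lra.
    - rewrite S_INR in Ha. destruct (IH (a + 1)%R) as [l [Hlim Hl]]; [lra|].
      exists (a * l)%R. split; [now apply euler_quotient_lim_shift|].
      intros E. apply Rmult_integral in E. destruct E as [E|E].
      + exists 0%nat. simpl. lra.
      + destruct (Hl E) as [m Hm]. exists (S m). rewrite S_INR. lra. }
  destruct (nfloor_ex (Rabs a)) as [N [_ HN]]; [apply Rabs_pos|].
  apply (H (S N)). rewrite S_INR.
  assert (Hb := Rabs_le_between a (Rabs a)). destruct Hb as [Hb _].
  specialize (Hb (Rle_refl _)). lra.
Qed.

Lemma rGamma_euler_quotient (a l : R) :
  is_lim_seq (euler_quotient a) l -> rGamma a = l.
Proof.
  intros H. apply Clim_seq_unique.
  apply (filterlim_ext_loc (fun n => RtoC (euler_quotient a n)));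
    [|now apply filterlim_RtoC_seq].
  exists 1%nat. intros n Hn.
  assert (Hn' : (0 < INR n)%R) by (apply lt_0_INR; lia).
  assert (Hf := INR_fact_pos n). assert (H1 := Rpower_pos (INR n) a).
  unfold euler_quotient. rewrite pochhammer_RtoC, Cpower_RtoC by exact Hn'.
  rewrite RtoC_div, RtoC_mult by (apply Rgt_not_eq; now apply Rmult_lt_0_compat).
  reflexivity.
Qed.

Lemma rGamma_shift (a : R) : rGamma a = a * rGamma (a + 1).
Proof.
  destruct (euler_quotient_lim (a + 1)) as [l [Hl _]].
  rewrite <- RtoC_plus, (rGamma_euler_quotient _ _ Hl), <- RtoC_mult.
  now apply rGamma_euler_quotient, euler_quotient_lim_shift.
Qed.

Lemma rGamma_neq_0 (a : R) : ~ gamma_pole a -> rGamma a <> 0.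
Proof.
  intros Ha. destruct (euler_quotient_lim a) as [l [Hl Hz]].
  rewrite (rGamma_euler_quotient _ _ Hl). apply RtoC_neq_0. intros E.
  apply Ha. destruct (Hz E) as [m Hm]. exists m. rewrite Hm. apply RtoC_opp.
Qed.

Lemma rGamma_pochhammer (a : R) (n : nat) :
  rGamma a = pochhammer a n * rGamma (a + INR n).
Proof.
  induction n as [|n IH].
  - simpl. rewrite Cplus_0_r. ring.
  - rewrite IH at 1. simpl pochhammer. rewrite S_INR, RtoC_plus.
    rewrite <- (RtoC_plus a), (rGamma_shift (a + INR n)), RtoC_plus, Cplus_assoc. ring.
Qed.

Lemma geometric_bound (u : nat -> R) (N : nat) :
  (forall n, (N <= n)%nat -> u (S n) <= 2 * u n)%R ->
  exists M, (0 <= M)%R /\ forall n, (u n <= M * 2 ^ n)%R.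
Proof.
  revert u. induction N as [|N IH]; intros u Hu.
  - exists (Rabs (u 0%nat)). split; [apply Rabs_pos|].
    induction n as [|n IHn]; simpl; [rewrite Rmult_1_r; apply Rle_abs|].
    specialize (Hu n ltac:(lia)). lra.
  - destruct (IH (fun n => u (S n))) as [M [HM Hb]].
    { intros n Hn. apply Hu. lia. }
    exists (M + Rabs (u 0%nat))%R. assert (H0 := Rabs_pos (u 0%nat)). split; [lra|].
    intros [|n].
    + simpl. assert (H := Rle_abs (u 0%nat)). lra.
    + specialize (Hb n). assert (Hp : (0 < 2 ^ n)%R) by (apply pow_lt; lra). simpl. nra.
Qed.

(** By the functional equation [n! / Gamma(a + n)] is multiplied by
    [(n + 1) / (a + n)] when [n] grows by one, hence at most doubled once
    [n > 2 |a| + 1]. *)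
Lemma Cmod_rGamma_bound (a : R) :
  exists M, (0 <= M)%R
    /\ forall n, (Cmod (rGamma (a + INR n)) <= M * 2 ^ n / INR (fact n))%R.
Proof.
  destruct (nfloor_ex (2 * Rabs a + 1)) as [N [_ HN]].
  { assert (H := Rabs_pos a). lra. }
  destruct (geometric_bound
    (fun n => INR (fact n) * Cmod (rGamma (a + INR n)))%R (S N)) as [M [HM Hb]].
  - intros n Hn. apply le_INR in Hn. rewrite S_INR in Hn.
    rewrite <- !RtoC_plus, (rGamma_shift (a + INR n)), Cmod_mult, Cmod_R.
    replace (RtoC (a + INR n) + 1) with (RtoC (a + INR (S n)))
      by (rewrite S_INR, !RtoC_plus; ring).
    rewrite INR_fact_S. assert (Hf := INR_fact_pos n).
    set (c := Cmod (rGamma (a + INR (S n))%R)).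
    assert (Hc : (0 <= c)%R) by apply Cmod_ge_0.
    assert (Ha := proj1 (Rabs_le_between a (Rabs a)) (Rle_refl _)).
    rewrite (Rabs_pos_eq (a + INR n)) by (assert (H := Rabs_pos a); lra).
    rewrite S_INR.
    apply Rle_trans with (2 * (a + INR n) * (INR (fact n) * c))%R; [|right; ring].
    replace ((INR n + 1) * INR (fact n) * c)%R
      with ((INR n + 1) * (INR (fact n) * c))%R by ring.
    apply Rmult_le_compat_r; [nra|lra].
  - exists M. split; [exact HM|]. intros n. assert (Hf := INR_fact_pos n).
    apply Rle_div_r; [exact Hf|]. rewrite Rmult_comm. apply Hb.
Qed.

(** * Pochhammer symbols and Laguerre polynomials *)

Lemma Cfact_neq_0 (n : nat) : RtoC (INR (fact n)) <> 0.
Proof. apply RtoC_neq_0, INR_fact_neq_0. Qed.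

Lemma Csucc_neq_0 (n : nat) : RtoC (INR (S n)) <> 0.
Proof. apply RtoC_neq_0, not_0_INR. lia. Qed.

Lemma Cmult_cancel_l (z a b : C) : z <> 0 -> z * a = z * b -> a = b.
Proof.
  intros Hz H. rewrite <- (Cmult_1_l a), <- (Cmult_1_l b), <- (Cinv_l z Hz).
  now rewrite <- !Cmult_assoc, H.
Qed.

Lemma Csum_shift (a : nat -> C) (n : nat) :
  sum_n (G := C_AbelianMonoid) a (S n)
  = a 0%nat + sum_n (G := C_AbelianMonoid) (fun k => a (S k)) n.
Proof.
  induction n as [|n IH].
  - rewrite Csum_Sn, !sum_O. reflexivity.
  - rewrite Csum_Sn, IH, (Csum_Sn (fun k => a (S k))). cring.
Qed.

Lemma convolution_recurrence (a b t : C) (p q : nat -> C) (m : nat) :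
  (forall i, INR (S i) * p (S i) = (a + t * INR i) * p i) ->
  (forall i, INR (S i) * q (S i) = (b + t * INR i) * q i) ->
  INR (S m) * sum_n (G := C_AbelianMonoid) (fun i => p i * q (S m - i)%nat) (S m)
  = (a + b + t * INR m)
    * sum_n (G := C_AbelianMonoid) (fun i => p i * q (m - i)%nat) m.
Proof.
  intros Hp Hq. rewrite <- !Csum_mult_l.
  transitivity (sum_n (G := C_AbelianMonoid)
      (fun i => INR i * p i * q (S m - i)%nat) (S m)
    + sum_n (G := C_AbelianMonoid)
      (fun i => p i * (INR (S m - i) * q (S m - i)%nat)) (S m)).
  { rewrite <- Csum_plus. apply sum_n_ext_loc. intros i Hi.
    rewrite minus_INR, RtoC_minus by exact Hi. cring. }
  rewrite Csum_shift, Csum_Sn, Nat.sub_diag.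
  transitivity (sum_n (G := C_AbelianMonoid)
      (fun i => INR (S i) * p (S i) * q (m - i)%nat) m
    + sum_n (G := C_AbelianMonoid)
      (fun i => p i * (INR (S m - i) * q (S m - i)%nat)) m).
  { change (INR 0) with 0%R.
    rewrite !Cmult_0_l, Cmult_0_r, Cplus_0_l, Cplus_0_r. reflexivity. }
  rewrite <- Csum_plus. apply sum_n_ext_loc. intros i Hi.
  replace (S m - i)%nat with (S (m - i)) by lia.
  rewrite Hp, Hq, minus_INR, RtoC_minus by exact Hi. cring.
Qed.

(** A sequence with [(i + 1) p_(i+1) = (a + t i) p_i] consists of the Taylor
    coefficients of a solution of [y' = a y + t z y'], and the product of two
    solutions solves the equation for the sum of the parameters.  The case
    [t = 1] is the Chu-Vandermonde identity and [t = 0] the binomial theorem. *)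
Lemma convolution_hypergeometric (a b t : C) (p q r : nat -> C) (m : nat) :
  p 0%nat * q 0%nat = r 0%nat ->
  (forall i, INR (S i) * p (S i) = (a + t * INR i) * p i) ->
  (forall i, INR (S i) * q (S i) = (b + t * INR i) * q i) ->
  (forall i, INR (S i) * r (S i) = (a + b + t * INR i) * r i) ->
  sum_n (G := C_AbelianMonoid) (fun i => p i * q (m - i)%nat) m = r m.
Proof.
  intros H0 Hp Hq Hr. induction m as [|m IH].
  - now rewrite sum_O.
  - assert (H := convolution_recurrence a b t p q m Hp Hq).
    rewrite IH, <- Hr in H.
    exact (Cmult_cancel_l (INR (S m)) _ _ (Csucc_neq_0 m) H).
Qed.

Lemma pochhammer_vandermonde (a b : C) (m : nat) :
  sum_n (G := C_AbelianMonoid)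
    (fun i => pochhammer a i / INR (fact i)
              * (pochhammer b (m - i) / INR (fact (m - i)))) m
  = pochhammer (a + b) m / INR (fact m).
Proof.
  assert (H : forall z i, INR (S i) * (pochhammer z (S i) / INR (fact (S i)))
                          = (z + 1 * INR i) * (pochhammer z i / INR (fact i))).
  { intros z i. rewrite INR_fact_S, RtoC_mult. simpl pochhammer.
    field. split; [apply Cfact_neq_0|apply Csucc_neq_0]. }
  apply (convolution_hypergeometric a b 1 (fun i => pochhammer a i / INR (fact i))
    (fun i => pochhammer b i / INR (fact i))
    (fun i => pochhammer (a + b) i / INR (fact i))); try (intros i; apply H).
  simpl. field.
Qed.

Lemma exponential_convolution (z w : C) (m : nat) :
  sum_n (G := C_AbelianMonoid)
    (fun i => z ^ i / INR (fact i) * (w ^ (m - i) / INR (fact (m - i)))) m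
  = (z + w) ^ m / INR (fact m).
Proof.
  assert (H : forall z i, INR (S i) * (z ^ (S i) / INR (fact (S i)))
                          = (z + 0 * INR i) * (z ^ i / INR (fact i))).
  { clear. intros z i. rewrite INR_fact_S, RtoC_mult, Cpow_S.
    field. split; [apply Cfact_neq_0|apply Csucc_neq_0]. }
  apply (convolution_hypergeometric z w 0 (fun i => z ^ i / INR (fact i))
    (fun i => w ^ i / INR (fact i))
    (fun i => (z + w) ^ i / INR (fact i))); try (intros i; apply H).
  simpl. field.
Qed.

(** The generating function [(1 - t)^(-beta-1) exp (- x t / (1 - t))] of the
    Laguerre polynomials becomes the one for [alpha] after multiplication by
    [(1 - t)^(beta-alpha)]; on coefficients of [x ^ j] this is the
    Chu-Vandermonde identity. *)
Lemma laguerre_poly_connection (a b x : C) (m : nat) :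
  sum_n (G := C_AbelianMonoid)
    (fun k => pochhammer (a - b) (m - k) / INR (fact (m - k))
              * laguerre_poly k b x) m
  = laguerre_poly m a x.
Proof.
  set (w := fun i => pochhammer (a - b) i / INR (fact i)).
  set (h := fun j i => pochhammer (b + INR j + 1) i
                       / (INR (fact i) * INR (fact j)) * (- x) ^ j).
  transitivity (sum_n (G := C_AbelianMonoid) (fun k => sum_n (G := C_AbelianMonoid)
    (fun j => w (m - (j + (k - j)))%nat * h j (k - j)%nat) k) m).
  { apply sum_n_ext_loc. intros k Hk.
    change (w (m - k)%nat * sum_n (G := C_AbelianMonoid) (fun j => h j (k - j)%nat) k
      = sum_n (G := C_AbelianMonoid)
          (fun j => w (m - (j + (k - j)))%nat * h j (k - j)%nat) k).
    rewrite <- Csum_mult_l. apply sum_n_ext_loc. intros j Hj.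
    now replace (j + (k - j))%nat with k by lia. }
  rewrite (sum_n_triangle (G := C_AbelianMonoid)
             (fun j i => w (m - (j + i))%nat * h j i) m).
  unfold laguerre_poly. apply sum_n_ext_loc. intros j Hj.
  transitivity ((- x) ^ j / INR (fact j) * sum_n (G := C_AbelianMonoid)
    (fun i => pochhammer (b + INR j + 1) i / INR (fact i)
       * (pochhammer (a - b) (m - j - i) / INR (fact (m - j - i)))) (m - j)).
  { rewrite <- Csum_mult_l. apply sum_n_ext. intros i. unfold w, h.
    replace (m - (j + i))%nat with (m - j - i)%nat by lia.
    cfield. repeat split; apply Cfact_neq_0. }
  rewrite pochhammer_vandermonde.
  replace (b + INR j + 1 + (a - b)) with (a + INR j + 1) by cring.
  cfield. split; apply Cfact_neq_0.
Qed.

(** The binomial coefficient of [p + m] and [p] is at most [2 ^ (p + m)]; Pascal's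
    rule appears as [(p + m)! = p (p + m - 1)! + m (p + m - 1)!]. *)
Lemma fact_add_le (p m : nat) : (fact (p + m) <= 2 ^ (p + m) * (fact p * fact m))%nat.
Proof.
  assert (H : forall s p m, (p + m = s)%nat ->
    (fact s <= 2 ^ s * (fact p * fact m))%nat); [|now apply H].
  clear. induction s as [|s IH]; intros p m E.
  - destruct p, m; simpl in *; lia.
  - destruct p as [|p], m as [|m]; try lia.
    + assert (s = m) by lia. subst s.
      assert (1 <= 2 ^ S m)%nat by (apply Nat.neq_0_lt_0, Nat.pow_nonzero; lia).
      simpl (fact 0). nia.
    + assert (s = p) by lia. subst s.
      assert (1 <= 2 ^ S p)%nat by (apply Nat.neq_0_lt_0, Nat.pow_nonzero; lia).
      simpl (fact 0). nia.
    + assert (H1 := IH p (S m) ltac:(lia)). assert (H2 := IH (S p) m ltac:(lia)).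
      change (fact (S s)) with (S s * fact s)%nat.
      change (2 ^ S s)%nat with (2 * 2 ^ s)%nat.
      replace (S s) with (S p + S m)%nat at 1 by lia.
      change (fact (S p)) with (S p * fact p)%nat in *.
      change (fact (S m)) with (S m * fact m)%nat in *.
      set (P := (2 ^ s)%nat) in *. nia.
Qed.

(** [|(z)_m| <= (p + 1)_m = (p + m)! / p!]. *)
Lemma Cmod_pochhammer_le (z : C) (p m : nat) :
  (Cmod z <= INR (S p))%R ->
  (Cmod (pochhammer z m) <= 2 ^ (p + m) * INR (fact m))%R.
Proof.
  intros Hz.
  assert (H : (Cmod (pochhammer z m) * INR (fact p) <= INR (fact (p + m)))%R).
  { induction m as [|m IH].
    - simpl. rewrite Cmod_1, Nat.add_0_r. lra.
    - simpl pochhammer. rewrite Cmod_mult, <- plus_n_Sm, INR_fact_S.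
      assert (Hm : (Cmod (z + INR m) <= INR (S (p + m)))%R).
      { eapply Rle_trans; [apply Cmod_triangle|].
        rewrite Cmod_R, Rabs_pos_eq by apply pos_INR.
        rewrite S_INR, plus_INR. rewrite S_INR in Hz. lra. }
      apply Rle_trans with
        (Cmod (z + INR m) * (Cmod (pochhammer z m) * INR (fact p)))%R; [right; ring|].
      apply Rmult_le_compat; [apply Cmod_ge_0| |exact Hm|exact IH].
      apply Rmult_le_pos; [apply Cmod_ge_0|apply pos_INR]. }
  assert (Hf := le_INR _ _ (fact_add_le p m)).
  rewrite !mult_INR, pow_INR in Hf.
  apply Rmult_le_reg_r with (INR (fact p)); [apply INR_fact_pos|].
  change (INR 2) with 2%R in Hf. lra.
Qed.

Lemma is_series_exp (t : R) : is_series (fun n => t ^ n / INR (fact n))%R (exp t).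
Proof.
  apply is_series_ext with (fun n => scal (pow_n t n) (/ INR (fact n))%R).
  - intros n. rewrite pow_n_pow. reflexivity.
  - exact (is_exp_Reals t).
Qed.

Lemma exp_partial_sum_le (t : R) (n : nat) :
  (0 <= t)%R -> (sum_n (fun k => t ^ k / INR (fact k))%R n <= exp t)%R.
Proof.
  intros Ht. apply (is_lim_seq_incr_compare (sum_n (fun k => t ^ k / INR (fact k))%R)).
  - exact (is_series_exp t).
  - intros k. rewrite Rsum_Sn.
    assert (0 <= t ^ S k / INR (fact (S k)))%R; [|lra].
    apply Rle_div_r; [apply INR_fact_pos|]. rewrite Rmult_0_l. now apply pow_le.
Qed.

Lemma Cmod_laguerre_poly_le (b x : C) (B k : nat) :
  (Cmod b <= INR B)%R ->
  (Cmod (laguerre_poly k b x) <= 2 ^ (B + k) * exp (Cmod x))%R.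
Proof.
  intros Hb. unfold laguerre_poly.
  apply Rle_trans with
    (sum_n (fun j => 2 ^ (B + k) * (Cmod x ^ j / INR (fact j))) k)%R.
  - apply Cmod_sum_le. intros j Hj.
    assert (Hp : (Cmod (pochhammer (b + INR j + 1) (k - j))
                  <= 2 ^ (B + k) * INR (fact (k - j)))%R).
    { replace (B + k)%nat with (B + j + (k - j))%nat by lia.
      apply Cmod_pochhammer_le.
      eapply Rle_trans; [apply Cmod_triangle|]. rewrite Cmod_1.
      assert (H := Cmod_triangle b (INR j)).
      rewrite Cmod_R, Rabs_pos_eq in H by apply pos_INR.
      rewrite S_INR, plus_INR. lra. }
    rewrite Cmod_mult, Cmod_div, Cmod_mult, Cmod_pow, Cmod_opp
      by (apply Cmult_neq_0; apply Cfact_neq_0).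
    rewrite !Cmod_R, !Rabs_pos_eq by apply pos_INR.
    assert (H1 := INR_fact_pos j). assert (H2 := INR_fact_pos (k - j)).
    apply Rle_trans with (Cmod (pochhammer (b + INR j + 1) (k - j)) / INR (fact (k - j))
                          * (Cmod x ^ j / INR (fact j)))%R; [right; field; lra|].
    apply Rmult_le_compat_r.
    + apply Rle_div_r; [exact H1|]. rewrite Rmult_0_l. apply pow_le, Cmod_ge_0.
    + now apply Rle_div_l.
  - assert (E := sum_n_mult_l (K := R_Ring) (2 ^ (B + k))%R
                   (fun j => Cmod x ^ j / INR (fact j))%R k).
    change mult with Rmult in E. simpl in E |- *.
    eapply Rle_trans; [right; exact E|].
    apply Rmult_le_compat_l; [apply pow_le; lra|].
    apply exp_partial_sum_le, Cmod_ge_0.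
Qed.

(** * The complex exponential series *)

Lemma Cmod_exp_term (z : C) (n : nat) :
  Cmod (z ^ n / INR (fact n)) = (Cmod z ^ n / INR (fact n))%R.
Proof.
  rewrite Cmod_div by apply Cfact_neq_0.
  rewrite Cmod_pow, Cmod_R, Rabs_pos_eq by apply pos_INR. reflexivity.
Qed.

Lemma ex_series_Cexp (z : C) :
  ex_series (V := C_NormedModule) (fun n => z ^ n / INR (fact n)).
Proof.
  apply Cex_series_dominated with (fun n => Cmod z ^ n / INR (fact n))%R.
  - intros n. right. apply Cmod_exp_term.
  - exists (exp (Cmod z)). apply is_series_exp.
Qed.

Lemma is_series_scal_C (z : C) (a : nat -> C) (s : C) :
  is_series (V := C_NormedModule) a s ->
  is_series (V := C_NormedModule) (fun n => z * a n) (z * s).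
Proof. exact (is_series_scal_l (V := C_NormedModule) z a s). Qed.

Lemma Cexp_series_plus (z w s t : C) :
  is_series (V := C_NormedModule) (fun n => z ^ n / INR (fact n)) s ->
  is_series (V := C_NormedModule) (fun n => w ^ n / INR (fact n)) t ->
  is_series (V := C_NormedModule) (fun n => (z + w) ^ n / INR (fact n)) (s * t).
Proof.
  intros Hs Ht.
  destruct (double_series_diagonal
    (fun k n => z ^ k / INR (fact k) * (w ^ n / INR (fact n)))
    (fun k => Cmod z ^ k / INR (fact k))%R (fun n => Cmod w ^ n / INR (fact n))%R
    (fun k => z ^ k / INR (fact k) * t)) as [u [Hu Hd]].
  - intros k. rewrite <- Cmod_exp_term. apply Cmod_ge_0.
  - intros k. rewrite <- Cmod_exp_term. apply Cmod_ge_0.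
  - eexists; apply is_series_exp.
  - eexists; apply is_series_exp.
  - intros k n. rewrite Cmod_mult, !Cmod_exp_term. apply Rle_refl.
  - intros k. now apply is_series_scal_C.
  - assert (E : u = s * t).
    { apply (Cis_series_unique _ _ _ Hu).
      rewrite Cmult_comm. eapply is_series_ext; [|apply (is_series_scal_C t _ _ Hs)].
      intros n. apply Cmult_comm. }
    rewrite <- E. eapply is_series_ext; [|exact Hd].
    intros m. apply exponential_convolution.
Qed.

Lemma Csum_RtoC (a : nat -> R) (n : nat) :
  sum_n (G := C_AbelianMonoid) (fun k => RtoC (a k)) n = RtoC (sum_n a n).
Proof.
  induction n as [|n IH]; [now rewrite !sum_O|].
  now rewrite Csum_Sn, Rsum_Sn, IH, <- RtoC_plus.
Qed.

Lemma Cexp_series_real (t : R) :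
  is_series (V := C_NormedModule) (fun n => RtoC t ^ n / INR (fact n)) (Cexp t).
Proof.
  rewrite Cexp_RtoC.
  apply is_series_ext with (fun n => RtoC (t ^ n / INR (fact n))).
  - intros n. rewrite RtoC_div, RtoC_pow by apply Rgt_not_eq, INR_fact_pos.
    reflexivity.
  - eapply filterlim_ext; [intros n; symmetry; exact (Csum_RtoC _ n)|].
    apply filterlim_RtoC_seq. exact (is_series_exp t).
Qed.

Lemma Ci_pow_even (n : nat) : Ci ^ (2 * n) = (-1) ^ n.
Proof.
  rewrite Cpow_mult_r. f_equal. unfold Ci, Cpow, Cmult, RtoC; simpl. f_equal; ring.
Qed.

(** Two consecutive terms of the exponential series at [i y] are one term of
    the cosine series and [i] times one term of the sine series. *)
Lemma Cexp_series_imaginary_partial (y : R) (n : nat) :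
  sum_n (G := C_AbelianMonoid) (fun k => (Ci * y) ^ k / INR (fact k)) (2 * n + 1)
  = sum_f_R0 (fun i => cos_n i * y² ^ i)%R n
    + Ci * (y * sum_f_R0 (fun i => sin_n i * y² ^ i)%R n)%R.
Proof.
  assert (Heven : forall k, (Ci * y) ^ (2 * k) / INR (fact (2 * k))
                            = RtoC (cos_n k * y² ^ k)%R).
  { intros k. rewrite Cpow_mult_l, Ci_pow_even. unfold cos_n.
    rewrite RtoC_mult, RtoC_div, !RtoC_pow by apply Rgt_not_eq, INR_fact_pos.
    unfold Rsqr. rewrite RtoC_mult, (Cpow_mult_r (RtoC y) 2 k).
    replace (RtoC y ^ 2) with (RtoC y * RtoC y) by ring.
    replace (RtoC (-1)) with (-(1)) by (rewrite <- RtoC_opp; f_equal; ring).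
    field. apply Cfact_neq_0. }
  assert (Hodd : forall k, (Ci * y) ^ (2 * k + 1) / INR (fact (2 * k + 1))
                            = Ci * RtoC (y * (sin_n k * y² ^ k))%R).
  { intros k. rewrite Cpow_add_r, Cpow_1_r, Cpow_mult_l, Ci_pow_even. unfold sin_n.
    rewrite !RtoC_mult, RtoC_div, !RtoC_pow by apply Rgt_not_eq, INR_fact_pos.
    unfold Rsqr. rewrite RtoC_mult, (Cpow_mult_r (RtoC y) 2 k).
    replace (RtoC y ^ 2) with (RtoC y * RtoC y) by ring.
    replace (RtoC (-1)) with (-(1)) by (rewrite <- RtoC_opp; f_equal; ring).
    field. apply Cfact_neq_0. }
  induction n as [|n IH].
  - change (2 * 0 + 1)%nat with 1%nat. rewrite Csum_Sn, sum_O.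
    assert (H0 := Heven 0%nat). assert (H1 := Hodd 0%nat).
    change (2 * 0)%nat with 0%nat in H0. change (2 * 0 + 1)%nat with 1%nat in H1.
    rewrite H0, H1. reflexivity.
  - replace (2 * S n + 1)%nat with (S (S (2 * n + 1))) by lia.
    rewrite !Csum_Sn, IH.
    assert (H0 := Heven (S n)). assert (H1 := Hodd (S n)).
    replace (2 * S n + 1)%nat with (S (S (2 * n + 1))) in H1 by lia.
    replace (2 * S n)%nat with (S (2 * n + 1)) in H0 by lia.
    rewrite H0, H1. rewrite !tech5, !RtoC_mult, !RtoC_plus, !RtoC_mult. cring.
Qed.

(** The full series converges, so its sum can be read off from the partial
    sums with an even number of terms. *)
Lemma Cexp_series_imaginary (y : R) :
  is_series (V := C_NormedModule) (fun n => (Ci * y) ^ n / INR (fact n))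
    (Cexp (Ci * y)).
Proof.
  destruct (ex_series_Cexp (Ci * y)) as [s Hs].
  assert (Hphi : forall n, (2 * n + 1 < 2 * S n + 1)%nat) by (intros; lia).
  assert (Hsub := filterlim_comp _ _ _ (fun n => 2 * n + 1)%nat _ _ _ _
    (eventually_subseq (fun n => 2 * n + 1)%nat Hphi) Hs).
  assert (Hc : is_lim_seq (sum_f_R0 (fun i => cos_n i * y² ^ i)%R) (cos y)).
  { unfold cos. destruct (exist_cos y²) as [c Hc]. apply is_lim_seq_Reals. exact Hc. }
  assert (Hsn : is_lim_seq (fun n => y * sum_f_R0 (fun i => sin_n i * y² ^ i) n)%R (sin y)).
  { unfold sin. destruct (exist_sin y²) as [c Hc'].
    apply (is_lim_seq_scal_l _ y c). apply is_lim_seq_Reals. exact Hc'. }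
  assert (Hl : filterlim (fun n => sum_n (G := C_AbelianMonoid)
     (fun k => (Ci * y) ^ k / INR (fact k)) (2 * n + 1)) eventually
     (locally (cos y + Ci * sin y))).
  { apply Cfilterlim_Cmod.
    apply is_lim_seq_le_le with (fun _ => 0%R)
      (fun n => Rabs (sum_f_R0 (fun i => cos_n i * y² ^ i) n - cos y)
         + Rabs (y * sum_f_R0 (fun i => sin_n i * y² ^ i) n - sin y))%R.
    - intros n. split; [apply Cmod_ge_0|]. rewrite Cexp_series_imaginary_partial.
      rewrite <- !Cmod_R, !RtoC_minus.
      rewrite <- (Rmult_1_l (Cmod (RtoC (y * _) - _))), <- Cmod_Ci, <- Cmod_mult.
      eapply Rle_trans; [|apply Cmod_triangle]. right. f_equal. ring.
    - apply is_lim_seq_const.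
    - replace 0%R with (0 + 0)%R by ring. apply is_lim_seq_plus'.
      + apply (is_lim_seq_abs_0 (fun n => sum_f_R0 (fun i => cos_n i * y² ^ i) n - cos y)%R).
        replace 0%R with (cos y - cos y)%R by ring.
        apply is_lim_seq_minus'; [exact Hc|apply is_lim_seq_const].
      + apply (is_lim_seq_abs_0
                 (fun n => y * sum_f_R0 (fun i => sin_n i * y² ^ i) n - sin y)%R).
        replace 0%R with (sin y - sin y)%R by ring.
        apply is_lim_seq_minus'; [exact Hsn|apply is_lim_seq_const]. }
  replace (Cexp (Ci * y)) with s; [exact Hs|].
  transitivity (cos y + Ci * sin y).
  { exact (eq_trans (eq_sym (Clim_seq_unique _ _ Hsub)) (Clim_seq_unique _ _ Hl)). }
  unfold Cexp, Ci, Cmult, Cplus, RtoC; simpl.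
  replace (0 * y - 1 * 0)%R with 0%R by ring.
  replace (0 * 0 + 1 * y)%R with y by ring. rewrite exp_0. f_equal; ring.
Qed.

Lemma is_series_Cexp (z : C) :
  is_series (V := C_NormedModule) (fun n => z ^ n / INR (fact n)) (Cexp z).
Proof.
  replace z with (Re z + Ci * Im z).
  - rewrite Cexp_plus.
    apply Cexp_series_plus; [apply Cexp_series_real|apply Cexp_series_imaginary].
  - destruct z as [a b]. unfold Ci, Cmult, Cplus, RtoC; simpl. f_equal; ring.
Qed.

(** * The two sides of the expansion *)

(** On the diagonal [j + i = m] of a double series this leaves a gamma factor
    that depends on [m] only. *)
Lemma rGamma_index_shift (a : R) (j i : nat) :
  rGamma (a + INR j + 1)
  = pochhammer (a + INR j + 1) i * rGamma (a + INR (j + i) + 1).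
Proof.
  rewrite <- !RtoC_plus, (rGamma_pochhammer (a + INR j + 1) i), <- RtoC_plus.
  do 3 f_equal. rewrite plus_INR. ring.
Qed.

Lemma Cmod_rGamma_index_bound (a : R) :
  exists M, (0 <= M)%R
    /\ forall n, (Cmod (rGamma (a + INR n + 1)) <= M * 2 ^ n / INR (fact n))%R.
Proof.
  destruct (Cmod_rGamma_bound (a + 1)) as [M [HM H]].
  exists M. split; [exact HM|]. intros n. specialize (H n).
  now replace (a + INR n + 1) with (RtoC (a + 1) + INR n) by (rewrite RtoC_plus; ring).
Qed.

(** Terms of the Bessel-Clifford function of order [nu] at [- w]; its value
    times [w ^ (nu / 2)] is [J_nu (2 sqrt w)]. *)
Definition clifford_term (nu w : C) (n : nat) : C :=
  rGamma (nu + INR n + 1) * ((- w) ^ n / INR (fact n)).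

(** One of the two factors [n!] in the denominator is enough for convergence. *)
Lemma Cmod_clifford_term_bound (a : R) :
  exists M, (0 <= M)%R /\ forall w n,
    (Cmod (clifford_term a w n) <= M * ((2 * Cmod w) ^ n / INR (fact n)))%R.
Proof.
  destruct (Cmod_rGamma_index_bound a) as [M [HM H]].
  exists M. split; [exact HM|]. intros w n. unfold clifford_term.
  rewrite Cmod_mult, Cmod_exp_term, Cmod_opp, Rpow_mult_distr.
  assert (Hf := INR_fact_pos n). assert (Hw : (0 <= Cmod w ^ n)%R) by apply pow_le, Cmod_ge_0.
  apply Rle_trans with ((M * 2 ^ n) * (Cmod w ^ n / INR (fact n)))%R; [|right; field; lra].
  apply Rmult_le_compat_r.
  - apply Rle_div_r; [exact Hf|]. now rewrite Rmult_0_l.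
  - eapply Rle_trans; [apply H|]. apply Rle_div_l; [exact Hf|].
    assert (H2 : (0 <= M * 2 ^ n)%R) by (apply Rmult_le_pos; [exact HM|apply pow_le; lra]).
    assert (H1 : (1 <= INR (fact n))%R)
      by (change 1%R with (INR 1); apply le_INR; apply lt_O_fact).
    nra.
Qed.

Lemma ex_series_clifford (a : R) (w : C) :
  ex_series (V := C_NormedModule) (clifford_term a w).
Proof.
  destruct (Cmod_clifford_term_bound a) as [M [HM H]].
  eapply Cex_series_dominated; [apply (H w)|].
  exists (M * exp (2 * Cmod w))%R.
  exact (is_series_scal_l M _ _ (is_series_exp (2 * Cmod w))).
Qed.

(** [1 / Gamma(a + 1)] is the constant term; the other terms are bounded by those
    of the exponential series, which gives continuity at 0. *)
Lemma clifford_near_0 (a : R) :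
  exists M, (0 <= M)%R /\ forall w,
    (Cmod (CSeries (clifford_term a w) - rGamma (a + 1))
     <= M * (exp (2 * Cmod w) - 1))%R.
Proof.
  destruct (Cmod_clifford_term_bound a) as [M [HM H]].
  exists M. split; [exact HM|]. intros w.
  assert (HS := is_series_scal_l M _ _ (is_series_exp (2 * Cmod w))).
  assert (HT := Cmod_series_tail_le (clifford_term a w) _ _ _ 0 (H w)
    (CSeries_correct _ (ex_series_clifford a w)) HS).
  rewrite !sum_O in HT. unfold clifford_term at 2 in HT. simpl in HT.
  rewrite Cplus_0_r in HT.
  replace (rGamma (a + 1) * (1 / 1)) with (rGamma (a + 1)) in HT by (field; apply C1_nz).
  eapply Rle_trans; [apply HT|]. right. change (scal M ?x) with (M * x)%R. field.
Qed.

Lemma clifford_at_0 (a : R) : CSeries (clifford_term a 0) = rGamma (a + 1).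
Proof.
  destruct (clifford_near_0 a) as [M [HM H]]. specialize (H 0).
  rewrite Cmod_0, Rmult_0_r, exp_0, Rminus_diag, Rmult_0_r in H.
  apply Ceq_minus, Cmod_eq_0. apply Rle_antisym; [exact H|apply Cmod_ge_0].
Qed.

Lemma clifford_continuous_0 (a x : R) :
  filterlim (fun r : C => CSeries (clifford_term a (x * r)))
    (locally (0 : C)) (locally (rGamma (a + 1))).
Proof.
  destruct (clifford_near_0 a) as [M [HM H]].
  apply (filterlim_locally_ball_norm (U := C_NormedModule)). intros eps.
  set (h := fun t : R => (M * (exp (2 * (Rabs x * t)) - 1))%R).
  assert (Hh : filterlim h (locally 0%R) (locally 0%R)).
  { replace 0%R with (h 0%R) at 2
      by (unfold h; rewrite !Rmult_0_r, exp_0; ring).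
    apply (ex_derive_continuous h). unfold h. auto_derive. exact I. }
  assert (Hn := filterlim_norm (V := C_NormedModule) (0 : C)).
  assert (E0 : norm (V := C_NormedModule) (0 : C) = 0%R) by apply Cmod_0.
  rewrite E0 in Hn.
  assert (Hc := filterlim_comp _ _ _ _ _ _ _ _ Hn Hh).
  assert (Hc' := proj1 (filterlim_locally _ _) Hc eps). clear Hc.
  revert Hc'. apply filter_imp. intros r Hr.
  unfold ball in Hr; simpl in Hr. unfold AbsRing_ball, abs, minus, plus, opp in Hr; simpl in Hr.
  rewrite Ropp_0, Rplus_0_r in Hr. apply Rabs_def2 in Hr. destruct Hr as [Hr _].
  eapply Rle_lt_trans; [apply H|]. rewrite Cmod_mult, Cmod_R. exact Hr.
Qed.

Lemma bessel_clifford (a x : R) (r : C) :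
  (0 < x)%R -> r <> 0 ->
  Rpower x (- a / 2) * BesselJ a (2 * Csqrt (x * r))
  = Cpower r (a / 2) * CSeries (clifford_term a (x * r)).
Proof.
  intros Hx Hr.
  assert (Hp : RtoC (Rpower x (- a / 2)) <> 0)
    by (apply RtoC_neq_0, Rgt_not_eq, Rpower_pos).
  assert (HS := is_series_scal_C (Cpower r (a / 2) / Rpower x (- a / 2)) _ _
                  (CSeries_correct _ (ex_series_clifford a (x * r)))).
  unfold BesselJ. erewrite CSeries_unique; [|eapply is_series_ext; [|exact HS]].
  - field. exact Hp.
  - intros n. apply (Cmult_cancel_l (Rpower x (- a / 2))); [exact Hp|].
    (* Bring the two principal powers next to each other. *)
    match goal with |- _ = ?p * (?s * ?c / ?f * ?g) =>
      transitivity (s * (p * c) / f * g);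
      [|cfield; apply Cfact_neq_0] end.
    rewrite Cpower_Csqrt by assumption. unfold clifford_term.
    replace (- (x * r)) with (- (1) * (x * r)) by ring. rewrite Cpow_mult_l.
    field. split; [apply Cfact_neq_0|exact Hp].
Qed.

Definition laguerre_coef_term (a b r : C) (k n : nat) : C :=
  pochhammer (a - b) n * r ^ n * rGamma (a + INR k + INR n + 1) / INR (fact n).

(** The bound is a product of a function of [k] and a function of [n] because
    [k! n! <= (k + n)!]. *)
Lemma Cmod_laguerre_coef_term_bound (a b : R) :
  exists M, (0 <= M)%R /\ forall r k n,
    (Cmod (laguerre_coef_term a b r k n)
     <= M * (2 ^ k / INR (fact k)) * ((4 * Cmod r) ^ n / INR (fact n)))%R.
Proof.
  destruct (Cmod_rGamma_index_bound a) as [M [HM H]].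
  destruct (nfloor_ex (Rabs (a - b))) as [p [_ Hp]]; [apply Rabs_pos|].
  exists (M * 2 ^ p)%R. split; [apply Rmult_le_pos; [exact HM|apply pow_le; lra]|].
  intros r k n. unfold laguerre_coef_term.
  rewrite Cmod_div by apply Cfact_neq_0.
  rewrite !Cmod_mult, Cmod_pow, Cmod_R, Rabs_pos_eq by apply pos_INR.
  assert (Hf := INR_fact_pos n). assert (Hk := INR_fact_pos k).
  assert (Hkn := INR_fact_pos (k + n)).
  assert (H1 : (Cmod (pochhammer (a - b) n) <= 2 ^ (p + n) * INR (fact n))%R).
  { apply Cmod_pochhammer_le. rewrite <- RtoC_minus, Cmod_R, S_INR. lra. }
  assert (H2 : (Cmod (rGamma (a + INR k + INR n + 1))
                <= M * 2 ^ (k + n) / (INR (fact k) * INR (fact n)))%R).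
  { rewrite <- (Cplus_assoc a), <- RtoC_plus, <- plus_INR.
    eapply Rle_trans; [apply H|]. unfold Rdiv. apply Rmult_le_compat_l.
    - apply Rmult_le_pos; [exact HM|apply pow_le; lra].
    - apply Rinv_le_contravar; [now apply Rmult_lt_0_compat|].
      rewrite <- mult_INR. apply le_INR. clear.
      induction k as [|k IH]; [simpl; lia|].
      rewrite Nat.add_succ_l. change (fact (S k)) with (S k * fact k)%nat.
      change (fact (S (k + n))) with (S (k + n) * fact (k + n))%nat. nia. }
  assert (Hr : (0 <= Cmod r ^ n)%R) by apply pow_le, Cmod_ge_0.
  apply Rle_div_l; [exact Hf|].
  apply Rle_trans with ((2 ^ (p + n) * INR (fact n)) * Cmod r ^ n
     * (M * 2 ^ (k + n) / (INR (fact k) * INR (fact n))))%R.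
  - apply Rmult_le_compat; [|apply Cmod_ge_0| |exact H2].
    + apply Rmult_le_pos; [apply Cmod_ge_0|exact Hr].
    + apply Rmult_le_compat_r; assumption.
  - right. rewrite !pow_add, (Rpow_mult_distr 4).
    replace (4 ^ n)%R with (2 ^ n * 2 ^ n)%R
      by (rewrite <- Rpow_mult_distr; f_equal; ring).
    field. lra.
Qed.

Lemma ex_series_laguerre_coef_term (a b : R) (r : C) (k : nat) :
  ex_series (V := C_NormedModule) (laguerre_coef_term a b r k).
Proof.
  destruct (Cmod_laguerre_coef_term_bound a b) as [M [HM H]].
  eapply Cex_series_dominated; [apply (H r k)|].
  eexists. exact (is_series_scal_l (M * (2 ^ k / INR (fact k)))%R _ _
                    (is_series_exp (4 * Cmod r))).
Qed.

(** For regular parameters the gamma factors of the coefficient and of the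
    Laguerre function cancel, which needs 1/Gamma to vanish only at the poles,
    and what remains is the entire series that defines the singular case. *)
Lemma laguerre_coef_series (a b : R) (k : nat) (r : C) :
  laguerre_coef a b k r = CSeries (laguerre_coef_term a b r k).
Proof.
  unfold laguerre_coef. destruct (excluded_middle_informative _) as [_|Hreg];
    [reflexivity|].
  assert (G1 : rGamma (b - a + 1) <> 0).
  { rewrite <- RtoC_minus, <- RtoC_plus. apply rGamma_neq_0.
    rewrite RtoC_plus, RtoC_minus. tauto. }
  assert (G2 : rGamma (b + 1 + INR k) <> 0).
  { rewrite <- !RtoC_plus. apply rGamma_neq_0. rewrite !RtoC_plus. tauto. }
  assert (G3 : rGamma (a + INR k + 1) <> 0).
  { rewrite <- !RtoC_plus. apply rGamma_neq_0. rewrite !RtoC_plus. tauto. }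
  unfold laguerre_fun, CGamma.
  replace (1 + (b - a) + (a + INR k)) with (b + 1 + INR k) by ring.
  assert (HM : KummerM (- (b - a)) (a + INR k + 1) r
               = / rGamma (a + INR k + 1) * CSeries (laguerre_coef_term a b r k)).
  { apply CSeries_unique.
    eapply is_series_ext; [|apply (is_series_scal_C (/ rGamma (a + INR k + 1)) _ _
      (CSeries_correct _ (ex_series_laguerre_coef_term a b r k)))].
    intros n. simpl. unfold laguerre_coef_term.
    assert (E := rGamma_index_shift a k n). rewrite plus_INR, RtoC_plus, Cplus_assoc in E.
    replace (- (b - a)) with (a - b) by cring.
    rewrite E in G3 |- *.
    assert (pochhammer (a + INR k + 1) n <> 0)
      by (intros Z; apply G3; rewrite Z; ring).
    assert (rGamma (a + INR k + INR n + 1) <> 0)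
      by (intros Z; apply G3; rewrite Z; ring).
    cfield. repeat split; try assumption. apply Cfact_neq_0. }
  rewrite HM. field. auto.
Qed.

(** Both sums are [r ^ m / Gamma(a + m + 1)] times [L_m^a(x)]: the first by
    the connection formula, the second by expanding [L_m^a] in powers of [x]. *)
Lemma laguerre_expansion_coefficient (a b x : R) (r : C) (m : nat) :
  sum_n (G := C_AbelianMonoid) (fun k => laguerre_coef_term a b r k (m - k)
                             * (r ^ k * laguerre_poly k b x)) m
  = sum_n (G := C_AbelianMonoid) (fun j => clifford_term a (x * r) j
                             * (r ^ (m - j) / INR (fact (m - j)))) m.
Proof.
  transitivity (r ^ m * rGamma (a + INR m + 1) * laguerre_poly m a x).
  - rewrite <- (laguerre_poly_connection a b x m), <- Csum_mult_l.
    apply sum_n_ext_loc. intros k Hk. unfold laguerre_coef_term.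
    rewrite <- (Cplus_assoc a (INR k)), <- RtoC_plus, <- plus_INR.
    replace (k + (m - k))%nat with m by lia.
    replace (r ^ m) with (r ^ (m - k) * r ^ k)
      by (rewrite <- Cpow_add_r; f_equal; lia).
    cfield. apply Cfact_neq_0.
  - unfold laguerre_poly. rewrite <- Csum_mult_l.
    apply sum_n_ext_loc. intros j Hj. unfold clifford_term.
    rewrite (rGamma_index_shift a j (m - j)).
    replace (j + (m - j))%nat with m by lia.
    replace (- (x * r)) with (- x * r) by ring. rewrite (Cpow_mult_l (- x)).
    replace (r ^ m) with (r ^ (m - j) * r ^ j)
      by (rewrite <- Cpow_add_r; f_equal; lia).
    cfield. split; apply Cfact_neq_0.
Qed.

Lemma exp_clifford_diagonal (a : R) (w r : C) :
  is_series (V := C_NormedModule)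
    (fun m => sum_n (G := C_AbelianMonoid)
       (fun j => clifford_term a w j * (r ^ (m - j) / INR (fact (m - j)))) m)
    (Cexp r * CSeries (clifford_term a w)).
Proof.
  destruct (Cmod_clifford_term_bound a) as [M [HM H]].
  destruct (double_series_diagonal
    (fun j n => clifford_term a w j * (r ^ n / INR (fact n)))
    (fun j => M * ((2 * Cmod w) ^ j / INR (fact j)))%R
    (fun n => Cmod r ^ n / INR (fact n))%R
    (fun j => clifford_term a w j * Cexp r)) as [s [Hs Hd]].
  - intros j. eapply Rle_trans; [apply Cmod_ge_0|apply (H w)].
  - intros n. rewrite <- Cmod_exp_term. apply Cmod_ge_0.
  - eexists. exact (is_series_scal_l M _ _ (is_series_exp (2 * Cmod w))).
  - eexists. apply is_series_exp.
  - intros j n. rewrite Cmod_mult, Cmod_exp_term. apply Rmult_le_compat_r; [|apply H].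
    rewrite <- Cmod_exp_term. apply Cmod_ge_0.
  - intros j. apply is_series_scal_C, is_series_Cexp.
  - replace (Cexp r * CSeries (clifford_term a w)) with s; [exact Hd|].
    apply (Cis_series_unique _ _ _ Hs).
    eapply is_series_ext; [|apply (is_series_scal_C (Cexp r) _ _
      (CSeries_correct _ (ex_series_clifford a w)))].
    intros n. apply Cmult_comm.
Qed.

(** The expansion without its branch factors, valid for every [r]: the row sums
    of a dominated double series whose diagonals are those of the product of the
    exponential and Bessel-Clifford series. *)
Lemma laguerre_expansion (a b x : R) (r : C) :
  is_series (V := C_NormedModule)
    (fun k => laguerre_coef a b k r * r ^ k * laguerre_poly k b x)
    (Cexp r * CSeries (clifford_term a (x * r))).
Proof.
  destruct (Cmod_laguerre_coef_term_bound a b) as [M [HM H]].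
  destruct (nfloor_ex (Rabs b)) as [B [_ HB]]; [apply Rabs_pos|].
  assert (HL : forall k, (Cmod (laguerre_poly k b x)
                          <= 2 ^ (S B + k) * exp (Rabs x))%R).
  { intros k. rewrite <- Cmod_R. apply Cmod_laguerre_poly_le.
    rewrite Cmod_R, S_INR. lra. }
  set (K := (M * 2 ^ S B * exp (Rabs x))%R).
  destruct (double_series_diagonal
    (fun k n => laguerre_coef_term a b r k n * (r ^ k * laguerre_poly k b x))
    (fun k => K * ((4 * Cmod r) ^ k / INR (fact k)))%R
    (fun n => (4 * Cmod r) ^ n / INR (fact n))%R
    (fun k => laguerre_coef a b k r * r ^ k * laguerre_poly k b x)) as [s [Hs Hd]].
  - assert (HK : (0 <= K)%R).
    { apply Rmult_le_pos; [|left; apply exp_pos].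
      apply Rmult_le_pos; [exact HM|apply pow_le; lra]. }
    intros k. apply Rmult_le_pos; [exact HK|]. apply Rle_div_r; [apply INR_fact_pos|].
    rewrite Rmult_0_l. apply pow_le. assert (Hr := Cmod_ge_0 r). lra.
  - intros n. apply Rle_div_r; [apply INR_fact_pos|].
    rewrite Rmult_0_l. apply pow_le. assert (Hr := Cmod_ge_0 r). lra.
  - eexists. exact (is_series_scal_l K _ _ (is_series_exp (4 * Cmod r))).
  - eexists. apply is_series_exp.
  - intros k n. rewrite !Cmod_mult, Cmod_pow.
    assert (Hr := Cmod_ge_0 r). assert (Hk := INR_fact_pos k).
    assert (Hn := INR_fact_pos n).
    apply Rle_trans with
      ((M * (2 ^ k / INR (fact k)) * ((4 * Cmod r) ^ n / INR (fact n)))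
       * (Cmod r ^ k * (2 ^ (S B + k) * exp (Rabs x))))%R.
    + apply Rmult_le_compat; [apply Cmod_ge_0| |apply H|].
      * apply Rmult_le_pos; [now apply pow_le|apply Cmod_ge_0].
      * apply Rmult_le_compat_l; [now apply pow_le|apply HL].
    + right. unfold K. rewrite pow_add, (Rpow_mult_distr 4 _ k).
      replace (4 ^ k)%R with (2 ^ k * 2 ^ k)%R
        by (rewrite <- Rpow_mult_distr; f_equal; ring).
      field. lra.
  - intros k. rewrite laguerre_coef_series, <- Cmult_assoc, (Cmult_comm (CSeries _)).
    eapply is_series_ext; [|apply (is_series_scal_C (r ^ k * laguerre_poly k b x) _ _
      (CSeries_correct _ (ex_series_laguerre_coef_term a b r k)))].
    intros n. apply Cmult_comm.
  - replace (Cexp r * CSeries (clifford_term a (x * r))) with s; [exact Hs|].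
    apply (Cis_series_unique _ _ _ Hd).
    eapply is_series_ext; [|apply exp_clifford_diagonal].
    intros m. symmetry. apply laguerre_expansion_coefficient.
Qed.

Theorem theorem9 (alpha beta x : R) (rho : C) (hx : (0 < x)%R) :
  let lhs (r : C) : C :=
    Rpower x (- alpha / 2) * BesselJ alpha (2 * Csqrt (x * r)) in
  let term (r : C) (k : nat) : C :=
    laguerre_coef alpha beta k r * r ^ k * laguerre_poly k beta x in
  let factor (r : C) : C := Cpower r (alpha / 2) in
  let rhs (r : C) : C := factor r * Cexp (- r) * CSeries (term r) in
  ex_series (V := C_NormedModule) (term rho)
  /\ (rho <> 0 -> lhs rho = rhs rho)
  /\ (rho = 0 ->
      exists l : C,
        filterlim (fun r : C => lhs r / factor r) (locally' rho) (locally l)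
        /\ filterlim (fun r : C => rhs r / factor r) (locally' rho) (locally l)
        /\ Cexp (- rho) * CSeries (term rho) = l).
Proof.
  intros lhs term factor rhs.
  assert (Hexp : forall r, Cexp (- r) * CSeries (term r)
                           = CSeries (clifford_term alpha (x * r))).
  { intros r. unfold term. rewrite (CSeries_unique _ _ (laguerre_expansion alpha beta x r)).
    rewrite Cexp_opp. field. apply Cexp_neq_0. }
  assert (Hrhs : forall r, rhs r = factor r * CSeries (clifford_term alpha (x * r))).
  { intros r. unfold rhs. now rewrite <- Cmult_assoc, Hexp. }
  assert (Hlhs : forall r : C, r <> 0 ->
            lhs r = factor r * CSeries (clifford_term alpha (x * r))).
  { intros r Hr. exact (bessel_clifford alpha x r hx Hr). }
  assert (Hfac : forall r : C, r <> 0 -> factor r <> 0).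
  { intros r Hr. unfold factor. rewrite Cpower_neq by exact Hr. apply Cexp_neq_0. }
  split; [|split].
  - eexists. apply laguerre_expansion.
  - intros Hr. now rewrite Hlhs, Hrhs.
  - intros ->. exists (rGamma (alpha + 1)).
    assert (Hlim : filterlim (fun r : C => CSeries (clifford_term alpha (x * r)))
                     (locally' (0 : C)) (locally (rGamma (alpha + 1)))).
    { eapply filterlim_filter_le_1; [|apply clifford_continuous_0].
      apply filter_le_within. }
    split; [|split].
    + refine (filterlim_ext_loc _ _ _ Hlim).
      unfold locally', within. apply filter_forall. intros r Hr. rewrite Hlhs by exact Hr.
      field. now apply Hfac.
    + refine (filterlim_ext_loc _ _ _ Hlim).
      unfold locally', within. apply filter_forall. intros r Hr. rewrite Hrhs.
      field. now apply Hfac.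
    + rewrite Hexp, Cmult_0_r. apply clifford_at_0.
Qed.
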